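(* Let $n\in\mathbb{N}$, let $\lambda$ be a partition of $n$ and let $U\in\mathrm{SYT}(\lambda)$. Then for $1\le b\le n$ we have the recursion $$(n-b)\,m_U(b)=\alpha_\lambda-\omega_U(b)+\sum_{a=1}^{b-1}m_U(a).$$
   Context: A partition $\lambda=(\lambda_1\ge\lambda_2\ge\dots)$ of $n$ is identified with its Young diagram $\{(i,j): i\ge 1,\ 1\le j\le\lambda_i\}$ (English convention: row $i$, column $j$). A tableau of shape $\lambda$ is a bijection $T:\lambda\to\{1,\dots,n\}$; $\mathrm{T}(\lambda)$ is the set of all tableaux. $\mathrm{SYT}(\lambda)\subseteq \mathrm{T}(\lambda)$ is the set of standard Young tableaux, i.e. tableaux increasing along rows from left to right and along columns from top to bottom. For a cell $x=(i,j)\in\lambda$ put $N_\lambda^+(x)=\{(i+1,j),(i,j+1)\}\cap\lambda$ and define its height $h'_\lambda(x)=(i-1)+(j-1)$. For an entry $a$ and a tableau $T$ put $h'(a,T)=h'_\lambda(T^{-1}(a))$. Novelli--Pak--Stoyanovskii algorithm corresponding to $U\in\mathrm{SYT}(\lambda)$: order the cells by $x\prec_U y :\Leftrightarrow U(x)<U(y)$. Given $T\in\mathrm{T}(\lambda)$ set $T_0=T$. If $T_s$ is not a standard Young tableau, let $x$ be the $\prec_U$-maximal cell with $N_\lambda^+(x)\neq\emptyset$ and $T_s(x)>\min\{T_s(y):y\in N_\lambda^+(x)\}$, and let $T_{s+1}$ be obtained from $T_s$ by exchanging the entry $T_s(x)$ with the entry $\min\{T_s(y):y\in N_\lambda^+(x)\}$.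 The process stops at the first tableau $T_r$ which is standard; write $r_U(T)=r$ and $\varphi_U(T)=T_r$. Exchange numbers: for $1\le a<b\le n$ let $m_U(a,b)$ be the number of tableaux $T\in\mathrm{T}(\lambda)$ such that the entries $a$ and $b$ are exchanged with each other at some step of the algorithm applied to $T$ (for each $T$ this happens at most once). It is known that $m_U(a,b)$ does not depend on the choice of $b>a$, and one writes $m_U(a)=m_U(a,b)$ for any $b$ with $a<b\le n$. (For $b=n$ the number $m_U(n)$ is not defined in this way; the product $(n-n)\,m_U(n)$ is read as $0$.) Total initial height: $\alpha_\lambda=\sum_{T\in\mathrm{T}(\lambda)}h'(b,T)$, which is independent of $b$ and equals $(n-1)!\sum_{x\in\lambda}h'_\lambda(x)$. Total terminal height: $\omega_U(b)=\sum_{T\in\mathrm{T}(\lambda)}h'(b,\varphi_U(T))$. *)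

(* Defs.v *)
From mathcomp Require Import all_boot all_fingroup.

Set Implicit Arguments.
Unset Strict Implicit.
Unset Printing Implicit Defensive.

Definition is_partition (n : nat) (lam : seq nat) : bool :=
  [&& sorted geq lam, all (leq 1) lam & sumn lam == n].

(* Rows and columns are numbered from 0: the pair (i, j) encodes the cell
   (i + 1, j + 1) of the diagram. For a partition of n, all cells fit in an
   n x n square. *)
Definition cell (n : nat) (lam : seq nat) : finType :=
  {x : 'I_n * 'I_n | x.2 < nth 0 lam x.1}.

(* Labels live in 'I_n.+1 so that the entries 1, ..., n keep their values;
   the label 0 is excluded in [tableaux]. *)
Notation filling n lam := {ffun cell n lam -> 'I_n.+1}.

Section Tableaux.

Variables (n : nat) (lam : seq nat).
Implicit Types (x y z : cell n lam) (S T U : filling n lam) (a b : nat).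

Definition row x : nat := (val x).1.
Definition col x : nat := (val x).2.

Definition height x : nat := row x + col x.

Definition succs x : {set cell n lam} :=
  [set y | (row y == (row x).+1) && (col y == col x)
        || (row y == row x) && (col y == (col x).+1)].

Definition tableaux : {set filling n lam} :=
  [set T : filling n lam | injectiveb T && (T @: setT == [set k : 'I_n.+1 | 0 < k])].

Definition SYT : {set filling n lam} :=
  [set T in tableaux |
    [forall x, forall y, (row x == row y) && (col x < col y) ==> (T x < T y)]
    && [forall x, forall y,
          (col x == col y) && (row x < row y) ==> (T x < T y)]].

Definition entry_height a T : nat :=
  if [pick x | T x == a :> nat] is Some x then height x else 0.

(* The default value x is returned only when [succs x] is empty. *)
Definition min_succ T x : cell n lam := [arg min_(y < x in succs x) T y].

Definition disordered T x : bool :=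
  (succs x != set0) && (T (min_succ T x) < T x).

Definition active_cell U T : option (cell n lam) :=
  [pick x | disordered T x & [forall y, disordered T y ==> (U y <= U x)]].

Definition exchange T x y : filling n lam := [ffun z => T (tperm x y z)].

Definition step U T : filling n lam :=
  if active_cell U T is Some x then exchange T x (min_succ T x) else T.

Definition step_exchanges U T a b : bool :=
  if active_cell U T is Some x then
    let y := min_succ T x in
    (T x == a :> nat) && (T y == b :> nat)
    || (T x == b :> nat) && (T y == a :> nat)
  else false.

(* The index of the first standard tableau among T, step U T, ...  The tableaux
   met before stopping are pairwise distinct, so that a search of length
   #|tableaux| is exhaustive; see [NPS_standard]. *)
Definition run_length U T : nat :=
  find (fun S => S \in SYT) (traject (step U) T #|tableaux|).

Definition NPS U T : filling n lam := iter (run_length U T) (step U) T.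

Definition exchange_number2 U a b : nat :=
  #|[set T in tableaux |
      [exists s : 'I_(run_length U T),
        step_exchanges U (iter s (step U) T) a b]]|.

(* For a < n, [exchange_number2 U a b] is the same for all b with a < b <= n;
   the representative b = n is used. For a = n the value is 0, as an entry is
   never exchanged with itself. *)
Definition exchange_number U a : nat := exchange_number2 U a n.

(* The same sum is obtained for every entry b with 1 <= b <= n in place of 1;
   see [initial_heightE]. *)
Definition initial_height : nat := \sum_(T in tableaux) entry_height 1 T.

Definition terminal_height U b : nat :=
  \sum_(T in tableaux) entry_height b (NPS U T).

Lemma exchange_tableaux T x y : T \in tableaux -> exchange T x y \in tableaux.
Proof.
rewrite !inE => /andP[/injectiveP injT /eqP imT]; apply/andP; split.
  by apply/injectiveP => z t; rewrite !ffunE => /injT /perm_inj.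
apply/eqP; rewrite -imT; apply/setP => k; apply/imsetP/imsetP => -[z _ ->].
  by exists (tperm x y z); rewrite ?ffunE.
by exists (tperm x y z); rewrite ?ffunE ?tpermK.
Qed.

Lemma step_tableaux U T : T \in tableaux -> step U T \in tableaux.
Proof.
by rewrite /step; case: active_cell => // x; apply: exchange_tableaux.
Qed.

Lemma iter_step_tableaux U T s :
  T \in tableaux -> iter s (step U) T \in tableaux.
Proof. by move=> TT; elim: s => //= s; apply: step_tableaux. Qed.

Lemma min_succP T x y : y \in succs x ->
  min_succ T x \in succs x /\ T (min_succ T x) <= T y.
Proof.
move=> xy; rewrite /min_succ /arg_min /extremum.
case: pickP => [z /andP[xz /forallP/(_ y)/implyP/(_ xy)] //|no].
case: (arg_minnP (P := [in succs x]) (fun z => T z : nat) xy) => z xz zmin.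
have /negP[] := no z; apply/andP; split => //.
by apply/forallP => t; apply/implyP => /zmin.
Qed.

Lemma height_succ x y : y \in succs x -> height y = (height x).+1.
Proof.
rewrite inE /height => /orP[] /andP[/eqP-> /eqP->]; first by rewrite addSn.
by rewrite addnS.
Qed.

Lemma ordered_succ T x y : T \in tableaux -> ~~ disordered T x ->
  y \in succs x -> T x < T y.
Proof.
rewrite inE => /andP[/injectiveP injT _] nd xy.
have [_ le_min] := min_succP T xy.
have neq : T x != T y :> nat.
  apply/eqP => /val_inj/injT eqxy; have := height_succ xy.
  by rewrite eqxy => /n_Sn.
rewrite ltn_neqAle neq /=; apply: leq_trans le_min.
have s0 : succs x != set0 by apply/set0Pn; exists y.
by move: nd; rewrite /disordered s0 /= -leqNgt.
Qed.

Lemma ordered_SYT T : is_partition n lam -> T \in tableaux ->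
  (forall x, ~~ disordered T x) -> T \in SYT.
Proof.
case/and3P => srt _ _ TT ord.
have lt_succ x y : y \in succs x -> T x < T y by apply: ordered_succ.
have lamS i j : i <= j -> nth 0 lam j <= nth 0 lam i.
  move=> ij; case: (ltnP j (size lam)) => [jl|jl]; last by rewrite nth_default.
  apply: (sorted_leq_nth (leT := geq)) => //.
  - by move=> a b c /= ba cb; apply: leq_trans cb ba.
  - by move=> a /=.
  - by rewrite inE (leq_ltn_trans ij).
rewrite inE TT /=; apply/andP; split; apply/forallP => x; apply/forallP => y;
  apply/implyP => /andP[/eqP eq1 lt2].
- have [d ed] : exists d, col y = col x + d.+1.
    by exists (col y - (col x).+1); rewrite addnS -addSn subnKC.
  elim: d x eq1 {lt2} ed => [|d IH] x eq1 ed.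
    by apply: lt_succ; rewrite inE eq1 ed addn1 !eqxx orbT.
  have lt_n : (col x).+1 < n.
    by apply: leq_ltn_trans (ltn_ord (val y).2); rewrite -/(col y) ed addnS ltnS leq_addr.
  have in_lam : (col x).+1 < nth 0 lam (row x).
    rewrite eq1; apply: leq_ltn_trans (valP y).
    by rewrite -/(col y) ed addnS ltnS leq_addr.
  pose z : cell n lam := exist _ ((val x).1, Ordinal lt_n) in_lam.
  have xz : z \in succs x by rewrite inE !eqxx orbT.
  by apply: ltn_trans (lt_succ _ _ xz) (IH z _ _); rewrite // ed addnS addSn.
- have [d ed] : exists d, row y = row x + d.+1.
    by exists (row y - (row x).+1); rewrite addnS -addSn subnKC.
  elim: d x eq1 {lt2} ed => [|d IH] x eq1 ed.
    by apply: lt_succ; rewrite inE eq1 ed addn1 !eqxx.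
  have lt_y : (row x).+1 <= row y by rewrite ed addnS ltnS leq_addr.
  have lt_n : (row x).+1 < n by apply: leq_ltn_trans (ltn_ord (val y).1).
  have in_lam : col x < nth 0 lam (row x).+1.
    by rewrite eq1; apply: leq_trans (valP y) (lamS _ _ lt_y).
  pose z : cell n lam := exist _ (Ordinal lt_n, (val x).2) in_lam.
  have xz : z \in succs x by rewrite inE !eqxx.
  by apply: ltn_trans (lt_succ _ _ xz) (IH z _ _); rewrite // ed addnS addSn.
Qed.

Lemma active_cellP U T : is_partition n lam -> T \in tableaux ->
  T \notin SYT -> exists2 x, active_cell U T = Some x & disordered T x.
Proof.
move=> plam TT nS; rewrite /active_cell.
case: pickP => [x /andP[dx _]|no]; first by exists x.
case/negP: nS; apply: ordered_SYT => // x; apply/negP => dx.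
case: (arg_maxnP (P := disordered T) (fun z => U z : nat) dx) => z dz zmax.
have /negP[] := no z; rewrite dz; apply/forallP => y.
by apply/implyP => /zmax.
Qed.

Definition weight T : nat := \sum_x T x * height x.

Lemma weight_step U T : is_partition n lam -> T \in tableaux ->
  T \notin SYT -> weight T < weight (step U T).
Proof.
move=> plam TT nS; have [x ax /andP[/set0Pn[y0 /(min_succP T)[xy _]] lt]] :=
  active_cellP U plam TT nS.
rewrite /step ax; set y := min_succ T x in xy lt *.
have hy := height_succ xy.
have neq : y != x by apply/eqP => e; move: lt; rewrite e ltnn.
have split F : \sum_z F z = F x + (F y + \sum_(z | (z != x) && (z != y)) F z).
  by rewrite (bigD1 x) // (bigD1 y).
rewrite /weight !split !ffunE tpermL tpermR hy.
rewrite [X in _ < _ + (_ + X)](eq_bigr (fun z => T z * height z)); last first.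
  by move=> z /andP[zx zy]; rewrite ffunE tpermD // eq_sym.
rewrite !addnA ltn_add2r !mulnS; set h := height x.
by rewrite addnCA [X in _ < X]addnCA [T y * h + _]addnC ltn_add2r.
Qed.

Lemma NPS_standard U T : is_partition n lam -> T \in tableaux ->
  NPS U T \in SYT.
Proof.
move=> plam TT; rewrite /NPS /run_length; set N := #|tableaux|.
have [hs|] := boolP (has [in SYT] (traject (step U) T N)).
  have := nth_find T hs; rewrite nth_traject //.
  by rewrite -{2}(size_traject (step U) T N) -has_find.
move=> /hasPn no.
have lt_w i : i < N ->
    weight (iter i (step U) T) < weight (iter i.+1 (step U) T).
  move=> iN; apply: weight_step => //; first exact: iter_step_tableaux.
  by apply: no; apply/trajectP; exists i.
have lt_w2 i j : i < j <= N ->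
    weight (iter i (step U) T) < weight (iter j (step U) T).
  case/andP; elim: j => // j IH; rewrite ltnS leq_eqVlt => /orP[/eqP->|ij] jN.
    exact: lt_w.
  by apply: ltn_trans (lt_w _ jN); apply: IH => //; apply: ltnW.
pose f (i : 'I_N.+1) := iter i (step U) T.
have neqf (i j : 'I_N.+1) : i < j -> f i != f j.
  move=> ij; apply/eqP => eqf; have := lt_w2 i j.
  by rewrite ij -ltnS ltn_ord -/(f i) -/(f j) eqf ltnn => /(_ isT).
have injf : injective f.
  move=> i j eqf; case: (ltngtP i j) => [lt|lt|/val_inj //].
    by have := neqf _ _ lt; rewrite eqf eqxx.
  by have := neqf _ _ lt; rewrite eqf eqxx.
have sub : f @: setT \subset tableaux.
  by apply/subsetP => _ /imsetP[i _ ->]; apply: iter_step_tableaux.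
by have := subset_leq_card sub; rewrite card_imset // cardsT card_ord ltnn.
Qed.

Lemma initial_heightE b : 1 <= b <= n ->
  initial_height = \sum_(T in tableaux) entry_height b T.
Proof.
case/andP => b0 bn.
have n0 : 1 < n.+1 by rewrite ltnS (leq_trans b0).
pose i1 := Ordinal n0; pose ib := Ordinal (bn : b < n.+1).
pose r T : filling n lam := [ffun x => tperm i1 ib (T x)].
have rK : involutive r by move=> T; apply/ffunP => x; rewrite !ffunE tpermK.
have pos (k : 'I_n.+1) : (0 < tperm i1 ib k) = (0 < k).
  by case: tpermP => [->|->|//] /=; rewrite ?b0.
have rT T : T \in tableaux -> r T \in tableaux.
  rewrite !inE => /andP[/injectiveP injT /eqP imT]; apply/andP; split.
    by apply/injectiveP => x y; rewrite !ffunE => /perm_inj/injT.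
  apply/eqP/setP => k; rewrite inE -pos.
  have -> : (0 < tperm i1 ib k) = (tperm i1 ib k \in T @: setT).
    by rewrite imT inE.
  apply/imsetP/imsetP => -[x _ e]; exists x => //.
    by rewrite e ffunE tpermK.
  by rewrite ffunE -e tpermK.
have rTE T : (r T \in tableaux) = (T \in tableaux).
  by apply/idP/idP => /rT //; rewrite rK.
rewrite /initial_height (reindex_inj (inv_inj rK)) /=.
apply: eq_big => T; first by rewrite rTE.
move=> _; rewrite /entry_height; congr (if _ is Some _ then _ else _).
apply: eq_pick => x; rewrite !ffunE -[1]/(val i1) -[b]/(val ib) !val_eqE.
by rewrite -[RHS](inj_eq (@perm_inj _ (tperm i1 ib))) tpermR.
Qed.

End Tableaux.

Arguments tableaux : clear implicits.
Arguments SYT : clear implicits.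
Arguments initial_height : clear implicits.

(* Main.v *)
Require Import Defs.
From mathcomp Require Import all_boot all_order all_algebra all_fingroup.
From mathcomp Require Import zify.

(** The recursion is a balance of heights. An exchange of a with b, where
    a < b, moves b one step away from the corner of the diagram and a one step
    towards it. Following the entry b through all runs of the algorithm, its
    total height therefore changes by the number of its exchanges with smaller
    entries minus the number of its exchanges with larger ones
    ([terminal_height_balance]):
      omega(b) + sum_(d > b) m(b, d) = alpha + sum_(a < b) m(a, b).
    As m(a, b) does not depend on b > a, this is the recursion.

    Two facts have to be proved: that a pair is exchanged at most once in a
    run, so that counting tableaux amounts to counting exchanges
    ([exchange_once]), and that m(a, b) is independent of b
    ([exchange_number2_indep]).

    Both rest on the decomposition of a run into phases, one for each cell c,
    in decreasing order of U c. In the phase of c, the cells before c are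
    untouched and the entry T c slides away from c through a region that is
    otherwise ordered ([phase], [phase_slide], [phase_next]). In every exchange
    the larger entry is the sliding one; hence all exchanges of b with smaller
    entries happen in the phase of the cell where b starts. During this phase
    b only moves to greater heights and never meets again an entry that it has
    passed, which gives [exchange_once].

    For the independence of b, let T' be T with the entries b and b + 1
    interchanged. The runs from T and T' go in parallel, with b and b + 1
    interchanged, until b and b + 1 are compared. This happens neither before
    the phase in which the second of the two starts to slide, nor in that phase
    before this entry has finished passing entries smaller than b. From then on
    neither entry is exchanged with a smaller one except b + 1 with b. So T
    exchanges a with b if and only if T' exchanges a with b + 1
    ([exchanged_swap]). *)

Section NPS.
Set Implicit Arguments.
Unset Strict Implicit.

Variables (n : nat) (lam : seq nat) (hlam : is_partition n lam).
Variables (U : filling n lam) (hU : U \in SYT n lam).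
Implicit Types (x y z c h w : cell n lam) (S T : filling n lam) (a b s : nat).

(** * Tableaux, disordered cells and active cells *)

Lemma tableau_inj T : T \in tableaux n lam -> injective T.
Proof. by rewrite inE => /andP[/injectiveP]. Qed.

Lemma tableau_gt0 T x : T \in tableaux n lam -> 0 < T x.
Proof.
rewrite inE => /andP[_ /eqP imT].
have: T x \in T @: setT by apply: imset_f.
by rewrite imT inE.
Qed.

Lemma tableau_surj T b : T \in tableaux n lam -> 0 < b <= n ->
  exists x, T x = b :> nat.
Proof.
rewrite inE => /andP[_ /eqP imT] /andP[b0 bn].
have: Ordinal (bn : b < n.+1) \in T @: setT by rewrite imT inE.
by case/imsetP => x _ e; exists x; rewrite -e.
Qed.

Lemma SYT_tableau T : T \in SYT n lam -> T \in tableaux n lam.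
Proof. by rewrite inE => /andP[]. Qed.

Lemma SYT_succ T x y : T \in SYT n lam -> y \in succs x -> T x < T y.
Proof.
rewrite !inE => /and3P[_ /forallP/(_ x)/forallP/(_ y)/implyP rw].
move=> /forallP/(_ x)/forallP/(_ y)/implyP cl.
case/orP => /andP[/eqP r /eqP c]; [apply: cl | apply: rw];
  by rewrite r c eqxx ltnSn.
Qed.

Lemma disorderedN S x : (forall y, y \in succs x -> S x < S y) ->
  ~~ disordered S x.
Proof.
move=> lt; apply/negP => /andP[/set0Pn[y xy] gt].
have [m _] := min_succP S xy.
by have := ltn_trans gt (lt _ m); rewrite ltnn.
Qed.

Lemma disordered_min S x : disordered S x ->
  min_succ S x \in succs x /\ S (min_succ S x) < S x.
Proof.
by case/andP => /set0Pn[y xy] gt; split=> //; have [] := min_succP S xy.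
Qed.

Lemma min_succ_unique S x y : S \in tableaux n lam -> y \in succs x ->
  (forall w, w \in succs x -> S y <= S w) -> min_succ S x = y.
Proof.
move=> TS xy le; have [m le'] := min_succP S xy.
apply: (tableau_inj TS); apply/val_inj/eqP.
by rewrite eqn_leq le' le.
Qed.

Lemma active_cell_some S x : active_cell U S = Some x ->
  disordered S x /\ forall y, disordered S y -> U y <= U x.
Proof.
rewrite /active_cell; case: pickP => // z /andP[dz /forallP m] [<-].
by split=> // y dy; have := m y; rewrite dy.
Qed.

Lemma active_cell_none S : active_cell U S = None ->
  forall x, ~~ disordered S x.
Proof.
rewrite /active_cell; case: pickP => // no _ x; apply/negP => dx.
case: (arg_maxnP (P := disordered S) (fun z => U z : nat) dx) => z dz zmax.
have /negP[] := no z; rewrite dz; apply/forallP => y.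
by apply/implyP => /zmax.
Qed.

Lemma active_cell_eq S x : disordered S x ->
  (forall y, disordered S y -> U y <= U x) -> active_cell U S = Some x.
Proof.
move=> dx mx; case E: (active_cell U S) => [y|].
  have [dy my] := active_cell_some E; congr Some.
  apply: (tableau_inj (SYT_tableau hU)); apply/val_inj/eqP.
  by rewrite eqn_leq mx // my.
by have := active_cell_none E x; rewrite dx.
Qed.

Lemma step_active S x : active_cell U S = Some x ->
  step U S = exchange S x (min_succ S x).
Proof. by rewrite /step => ->. Qed.

(** In an exchange, the larger entry is the one at the active cell. *)
Lemma step_exchangesE S x a b : active_cell U S = Some x -> a < b ->
  step_exchanges U S a b = (S x == b :> nat) && (S (min_succ S x) == a :> nat).
Proof.
move=> ax ab; rewrite /step_exchanges ax.
have [_] := disordered_min (active_cell_some ax).1.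
by move: (min_succ S x) => y gt; lia.
Qed.

Lemma step_exchanges_none S a b : active_cell U S = None ->
  step_exchanges U S a b = false.
Proof. by rewrite /step_exchanges => ->. Qed.

Lemma succ_neq x y : y \in succs x -> y != x.
Proof.
by move=> xy; apply/eqP => e; have := height_succ xy; rewrite e => /n_Sn.
Qed.

Lemma succ_succ_neq x y w : y \in succs x -> w \in succs y -> w != x.
Proof.
move=> xy yw; apply/eqP => e; have := height_succ yw.
by rewrite e (height_succ xy); elim: (height x) => // m IH [/IH].
Qed.

(** * Phases *)

(** [phase T S c h]: the tableau S can occur in a run from T while the entry
    T c, which started at c, is at the cell h. The cells preceding c in the
    order given by U still have their entries of T; among the other cells, only
    h may be disordered. The field [phase_gap] states that the predecessors of
    h are also smaller than the successors of h; it ensures that they stay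
    ordered when a successor of h moves into h. *)
Record phase T S c h : Prop := Phase {
  phase_tableau : S \in tableaux n lam;
  phase_le : U c <= U h;
  phase_initial : forall z, U z < U c -> S z = T z;
  phase_entry : S h = T c;
  phase_ordered : forall z y, U c <= U z -> z != h -> y \in succs z ->
    S z < S y;
  phase_gap : forall z y, U c <= U z -> h \in succs z -> y \in succs h ->
    S z < S y }.

Lemma phase_start T S c : S \in tableaux n lam ->
  (forall z, U z <= U c -> S z = T z) ->
  (forall z, U c < U z -> ~~ disordered S z) -> phase T S c c.
Proof.
move=> TS eqST ord; split=> //.
- by move=> z /ltnW; apply: eqST.
- exact: eqST.
- move=> z y le zc; apply: ordered_succ => //; apply: ord.
  rewrite ltn_neqAle le andbT eq_sym; apply: contra zc => /eqP e.
  by apply/eqP/(tableau_inj (SYT_tableau hU))/val_inj.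
- by move=> z y le /(SYT_succ hU); rewrite ltnNge le.
Qed.

Lemma phase_slide T S c h : phase T S c h -> disordered S h ->
  phase T (exchange S h (min_succ S h)) c (min_succ S h).
Proof.
move=> [TS le init ent ord gap] dh.
have [hy lt] := disordered_min dh.
have miny w : w \in succs h -> S (min_succ S h) <= S w.
  by move=> /(min_succP S)[].
move: (min_succ S h) hy lt miny => y hy lt miny.
have Uhy := SYT_succ hU hy; have yh := succ_neq hy.
have ley : U c <= U y by apply: leq_trans le (ltnW Uhy).
have ltS w : w \in succs h -> w != y -> S y < S w.
  move=> hw wy; rewrite ltn_neqAle miny // andbT eq_sym.
  by apply: contra wy => /eqP e; apply/eqP/(tableau_inj TS)/val_inj.
split=> //.
- exact: exchange_tableaux.
- move=> z zc; rewrite ffunE tpermD ?init //.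
    by apply: contraTneq zc => <-; rewrite -leqNgt.
  by apply: contraTneq zc => <-; rewrite -leqNgt.
- by rewrite ffunE tpermR.
- move=> z w lez zy zw; rewrite !ffunE.
  case: (tpermP h y w) => [ew|ew|/eqP wh /eqP wy].
  + subst w; have zh : z != h by rewrite eq_sym succ_neq.
    by rewrite tpermD 1?eq_sym //; apply: gap.
  + subst w; case: (tpermP h y z) => [_//|ez|/eqP zh _].
      by rewrite ez eqxx in zy.
    by apply: ltn_trans lt; apply: ord.
  + case: (tpermP h y z) => [ez|ez|/eqP zh _].
    * by apply: ltS; rewrite -?ez.
    * by rewrite ez eqxx in zy.
    * exact: ord.
- move=> z w lez zy yw; rewrite !ffunE.
  have wy := succ_neq yw.
  have wh : w != h.
    exact: succ_succ_neq hy yw.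
  have Syw : S y < S w by apply: ord.
  rewrite (@tpermD _ _ _ w) 1?eq_sym //.
  case: (tpermP h y z) => [//|ez|/eqP zh _].
    by have := succ_neq zy; rewrite ez eqxx.
  by apply: ltn_trans Syw; apply: ord.
Qed.

Lemma phase_disordered T S c h x : phase T S c h -> disordered S x ->
  x != h -> U x < U c.
Proof.
move=> ph dx xh; rewrite ltnNge; apply/negP => le.
have /negP[] : ~~ disordered S x; last by [].
by apply: disorderedN => y; apply: (phase_ordered ph).
Qed.

Lemma phase_active T S c h : phase T S c h -> disordered S h ->
  active_cell U S = Some h.
Proof.
move=> ph dh; apply: active_cell_eq => // y dy.
have [->//|yh] := eqVneq y h.
by have := phase_disordered ph dy yh; have := phase_le ph; lia.
Qed.

Lemma phase_step T S c h : phase T S c h -> disordered S h ->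
  phase T (step U S) c (min_succ S h).
Proof.
by move=> ph dh; rewrite (step_active (phase_active ph dh)); apply: phase_slide.
Qed.

Lemma phase_restart T S c h c' : phase T S c h -> ~~ disordered S h ->
  U c' < U c -> (forall z, U c' < U z < U c -> ~~ disordered S z) ->
  phase T S c' c'.
Proof.
move=> ph nd lt btw; apply: phase_start; first exact: phase_tableau ph.
  by move=> z le; apply: (phase_initial ph); apply: leq_ltn_trans lt.
move=> z lz; have [|le] := ltnP (U z) (U c); first by move=> ?; apply: btw; lia.
apply/negP => dz; have [e|zh] := eqVneq z h; first by rewrite -e dz in nd.
by have := phase_disordered ph dz zh; lia.
Qed.

(** If the sliding entry has come to rest, the next exchange starts the phase
    of an earlier cell. *)
Lemma phase_next T S c h x : phase T S c h -> ~~ disordered S h ->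
  active_cell U S = Some x -> U x < U c /\ phase T S x x.
Proof.
move=> ph nd ax; have [dx mx] := active_cell_some ax.
have xh : x != h by apply: contraNneq nd => <-.
have lt := phase_disordered ph dx xh; split=> //.
apply: (phase_restart ph) => // z /andP[lz _].
by apply/negP => /mx; lia.
Qed.

(** A run can be seen as starting with the phase of the last cell c for U. The
    cell x only witnesses that the diagram is not empty. *)
Lemma phase0 T x : T \in tableaux n lam ->
  exists2 c, phase T T c c & forall z, U z <= U c.
Proof.
move=> TT; case: (arg_maxnP (P := predT) (fun z => U z : nat) (erefl (predT x))).
move=> c _ mc; have {}mc z : U z <= U c := mc z isT.
by exists c => //; apply: phase_start => // z; rewrite ltnNge mc.
Qed.

Lemma phase_at T s x : T \in tableaux n lam ->
  active_cell U (iter s (step U) T) = Some x ->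
  exists c, phase T (iter s (step U) T) c x.
Proof.
move=> TT; suff [c [h ph]] : exists c h, phase T (iter s (step U) T) c h.
  move=> ax; have [dh|nd] := boolP (disordered (iter s (step U) T) h).
    by move: ax; rewrite (phase_active ph dh) => -[<-]; exists c.
  by have [_] := phase_next ph nd ax; exists x.
elim: s => [|s [c [h ph]]] /=; first by have [c] := phase0 x TT; exists c, c.
have [dh|nd] := boolP (disordered (iter s (step U) T) h).
  by have := phase_step ph dh; exists c, (min_succ (iter s (step U) T) h).
case ay: (active_cell U (iter s (step U) T)) => [y|].
  have [_ py] := phase_next ph nd ay.
  have [dy _] := active_cell_some ay.
  by have := phase_step py dy; exists y, (min_succ (iter s (step U) T) y).
by rewrite /step ay; exists c, h.
Qed.

(** An exchange is followed by an exchange in the same phase at the new place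
    of the sliding entry, or by one in the phase of an earlier cell. *)
Lemma phase_trans T S c x c' x' : T \in tableaux n lam ->
  phase T S c x -> active_cell U S = Some x ->
  phase T (step U S) c' x' -> active_cell U (step U S) = Some x' ->
  c' = c /\ x' = min_succ S x \/ U c' < U c.
Proof.
move=> TT ph ax ph' ax'; have [dx _] := active_cell_some ax.
have ph1 := phase_step ph dx.
have [d|nd] := boolP (disordered (step U S) (min_succ S x)).
  left; move: ax'; rewrite (phase_active ph1 d) => -[e]; split=> //.
  apply: (tableau_inj TT).
  by rewrite -(phase_entry ph') -(phase_entry ph1) e.
right; have [lt ph2] := phase_next ph1 nd ax'.
suff -> : c' = x' by [].
by apply: (tableau_inj TT); rewrite -(phase_entry ph') -(phase_entry ph2).
Qed.

(** * Two entries are exchanged at most once *)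

(** At time t, the phase of p is over, or it is going on and the entry a lies
    at a smaller height than the sliding entry. The latter cannot meet a again,
    as it only exchanges places with entries at greater heights. *)
Definition passed T a p t : Prop := forall x c,
  active_cell U (iter t (step U) T) = Some x ->
  phase T (iter t (step U) T) c x ->
  U c < U p \/ c = p /\ forall z, iter t (step U) T z = a :> nat ->
                          height z < height x.

Lemma passedS T a p t : T \in tableaux n lam ->
  passed T a p t -> passed T a p t.+1.
Proof.
move=> TT G x' c' /=.
case ax: (active_cell U (iter t (step U) T)) => [x|]; last first.
  by rewrite [step U _]/step ax ax.
move=> ax' ph'; have [c ph] := phase_at TT ax.
have lt_c := G _ _ ax ph.
have [[ec ex]|lt] := phase_trans TT ph ax ph' ax'; last first.
  by left; case: lt_c => [|[<- _]//]; apply: ltn_trans.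
rewrite ec; case: lt_c => [|[e hz]]; [by left|right; split=> // z].
have [xy _] := disordered_min (active_cell_some ax).1.
rewrite -ex in xy; have hx := height_succ xy.
rewrite (step_active ax) ffunE -ex.
case: tpermP => [-> /hz|-> /hz|_ _ /hz]; rewrite ?hx; lia.
Qed.

Lemma exchange_once T a b s t : T \in tableaux n lam -> a < b ->
  step_exchanges U (iter s (step U) T) a b ->
  step_exchanges U (iter t (step U) T) a b -> s = t.
Proof.
move=> TT ab.
wlog lt : s t / s < t.
  by move=> W Es Et; case: (ltngtP s t) => // lt; [|apply/esym]; apply: W lt _ _.
move=> Es Et.
case ax: (active_cell U (iter s (step U) T)) Es => [x|]; last first.
  by rewrite step_exchanges_none.
rewrite (step_exchangesE ax) // => /andP[/eqP Sx /eqP Sy].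
have [c ph] := phase_at TT ax.
have G1 : passed T a c s.+1.
  move=> x' c' /= ax' ph'.
  have [[-> ex]|] := phase_trans TT ph ax ph' ax'; [right|by left].
  split=> // z; have [xy _] := disordered_min (active_cell_some ax).1.
  have TS := phase_tableau (phase_step ph (active_cell_some ax).1).
  move=> e; suff -> : z = x by rewrite ex (height_succ xy).
  apply: (tableau_inj TS); apply: val_inj.
  by rewrite /= e (step_active ax) ffunE tpermL.
have Gt : passed T a c t.
  rewrite -(subnKC lt); elim: (t - s.+1) => [|d IH]; first by rewrite addn0.
  by rewrite addnS; apply: passedS.
case ay: (active_cell U (iter t (step U) T)) Et => [y|]; last first.
  by rewrite step_exchanges_none.
rewrite (step_exchangesE ay) // => /andP[/eqP Sx' /eqP Sy'].
have [c' ph'] := phase_at TT ay.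
have ec : c' = c.
  apply: (tableau_inj TT); apply: val_inj => /=.
  by rewrite -(phase_entry ph') -(phase_entry ph) Sx Sx'.
case: (Gt _ _ ay ph') => [|[_ /(_ _ Sy')]]; first by rewrite ec ltnn.
by have [/height_succ->] := disordered_min (active_cell_some ay).1; lia.
Qed.

(** The entries a and b are exchanged with each other in the run from T. *)
Definition exchanged T a b : bool :=
  [exists s : 'I_(run_length U T), step_exchanges U (iter s (step U) T) a b].

Lemma SYT_active S : S \in SYT n lam -> active_cell U S = None.
Proof.
move=> sS; case ax: (active_cell U S) => [x|//].
have [dx _] := active_cell_some ax.
by have /negP[] : ~~ disordered S x by apply: disorderedN => y; apply: SYT_succ.
Qed.

Lemma iter_step_stop T s : T \in tableaux n lam -> run_length U T <= s ->
  iter s (step U) T \in SYT n lam.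
Proof.
move=> TT le; rewrite -(subnK le) iterD.
elim: (s - _) => [|d IH] /=; first exact: (NPS_standard U hlam TT).
by rewrite /step SYT_active.
Qed.

(** The bound on the time is immaterial: nothing moves once the tableau is
    standard. *)
Lemma exchangedP T a b : T \in tableaux n lam ->
  reflect (exists s, step_exchanges U (iter s (step U) T) a b)
          (exchanged T a b).
Proof.
move=> TT; apply: (iffP existsP) => [[s E]|[s E]]; first by exists s.
have [lt|le] := ltnP s (run_length U T); first by exists (Ordinal lt).
by move: E; rewrite step_exchanges_none // SYT_active // iter_step_stop.
Qed.

Lemma exchanged_sum T a b : T \in tableaux n lam -> a < b ->
  \sum_(s < run_length U T) step_exchanges U (iter s (step U) T) a b
  = exchanged T a b.
Proof.
move=> TT ab; rewrite /exchanged; case: existsP => [[s E]|no].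
  rewrite (bigD1 s) //= E big1 // => t ts.
  apply/eqP; rewrite eqb0; apply: contra ts => Et.
  by apply/eqP/val_inj/(exchange_once TT ab Et E).
rewrite big1 // => s _; apply/eqP; rewrite eqb0; apply/negP => E.
by case: no; exists s.
Qed.

(** * Balance of heights *)

Lemma entry_heightE S x b : S \in tableaux n lam -> S x = b :> nat ->
  entry_height b S = height x.
Proof.
move=> TS Sx; rewrite /entry_height; case: pickP => [y /eqP Sy|/(_ x)].
  by congr height; apply: (tableau_inj TS); apply: val_inj; rewrite /= Sx Sy.
by rewrite Sx eqxx.
Qed.

Lemma sum_nat_eq (m k v : nat) (B : bool) :
  \sum_(m <= i < k) ((v == i) && B) = (m <= v < k) && B.
Proof.
elim: k => [|k IH]; first by rewrite big_geq // ltn0 andbF.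
have [le|lt] := leqP m k; last by rewrite big_geq //; lia.
by rewrite big_nat_recr //= IH; case: B {IH}; lia.
Qed.

(** At most one term of each sum is nonzero: the first sum is 1 if b gives way
    to the sliding entry, the second one is 1 if b is the sliding entry. *)
Lemma entry_height_step S b : S \in tableaux n lam -> 0 < b <= n ->
  entry_height b (step U S) + \sum_(b.+1 <= d < n.+1) step_exchanges U S b d
  = entry_height b S + \sum_(1 <= a < b) step_exchanges U S a b.
Proof.
move=> TS bn; case ax: (active_cell U S) => [x|]; last first.
  by rewrite /step ax !big1 // => i _; rewrite step_exchanges_none.
have [xy lt] := disordered_min (active_cell_some ax).1.
have -> : \sum_(b.+1 <= d < n.+1) step_exchanges U S b d
          = (S (min_succ S x) == b :> nat).
  rewrite (eq_big_nat _ _ (F2 := fun d => (S x == d :> nat) &&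
      (S (min_succ S x) == b :> nat) : nat)); last first.
    by move=> d /andP[bd _]; rewrite (step_exchangesE ax).
  rewrite sum_nat_eq; have := ltn_ord (S x).
  by case: eqP => [e|_]; rewrite ?andbF // -e lt => ->.
have -> : \sum_(1 <= a < b) step_exchanges U S a b = (S x == b :> nat).
  rewrite (eq_big_nat _ _ (F2 := fun a => (S (min_succ S x) == a :> nat) &&
      (S x == b :> nat) : nat)); last first.
    by move=> a /andP[_ ab]; rewrite (step_exchangesE ax) // andbC.
  rewrite sum_nat_eq; have := tableau_gt0 (min_succ S x) TS.
  by case: eqP => [e|_]; rewrite ?andbF // -e lt => ->.
have [z Sz] := tableau_surj TS bn.
have TS' : step U S \in tableaux n lam by apply: step_tableaux.
have Sz' : step U S (tperm x (min_succ S x) z) = b :> nat.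
  by rewrite (step_active ax) ffunE tpermK.
rewrite (entry_heightE TS Sz) (entry_heightE TS' Sz').
have eqb w : (S w == b :> nat) = (w == z).
  by rewrite -Sz; apply: (inj_eq (inj_comp val_inj (tableau_inj TS))).
have hy := height_succ xy; have yx := succ_neq xy.
rewrite !eqb; case: tpermP => [->|->|/eqP zx /eqP zy].
- by rewrite eqxx (negPf yx) hy; lia.
- by rewrite eqxx eq_sym (negPf yx) hy; lia.
- by rewrite eq_sym (negPf zy) eq_sym (negPf zx).
Qed.

Lemma entry_height_NPS T b : T \in tableaux n lam -> 0 < b <= n ->
  entry_height b (NPS U T) + \sum_(b.+1 <= d < n.+1) exchanged T b d
  = entry_height b T + \sum_(1 <= a < b) exchanged T a b.
Proof.
move=> TT bn.
have tel k : entry_height b (iter k (step U) T)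
    + \sum_(b.+1 <= d < n.+1) \sum_(s < k)
        step_exchanges U (iter s (step U) T) b d
    = entry_height b T + \sum_(1 <= a < b) \sum_(s < k)
        step_exchanges U (iter s (step U) T) a b.
  elim: k => [|k IH].
    by rewrite !big1 // => i _; rewrite big_ord0.
  have recr (u v : nat) (F : nat -> nat -> nat) :
      \sum_(u <= i < v) \sum_(s < k.+1) F s i
      = \sum_(u <= i < v) \sum_(s < k) F s i + \sum_(u <= i < v) F k i.
    by rewrite -big_split; apply: eq_bigr => i _; rewrite big_ord_recr.
  rewrite (recr _ _ (fun s d => step_exchanges U (iter s (step U) T) b d)).
  rewrite (recr _ _ (fun s a => step_exchanges U (iter s (step U) T) a b)).
  rewrite iterS addnCA (entry_height_step (iter_step_tableaux U k TT) bn).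
  by rewrite addnA [X in X + _]addnC IH -addnA.
have := tel (run_length U T); rewrite -/(NPS U T).
rewrite [X in _ + X = _](eq_big_nat _ _ (F2 := fun d => exchanged T b d : nat)).
  rewrite [X in _ = _ + X](eq_big_nat _ _ (F2 := fun a => exchanged T a b : nat)).
    by [].
  by move=> a /andP[_ ab]; apply: exchanged_sum.
by move=> d /andP[bd _]; apply: exchanged_sum.
Qed.

Lemma exchange_number2E a b :
  exchange_number2 U a b = \sum_(T in tableaux n lam) exchanged T a b.
Proof.
rewrite /exchange_number2 -sum1_card [RHS]big_mkcond [LHS]big_mkcond.
by apply: eq_bigr => T _; rewrite inE /exchanged; case: (T \in _); case: [exists _, _].
Qed.

Lemma terminal_height_balance b : 0 < b <= n ->
  terminal_height U b + \sum_(b.+1 <= d < n.+1) exchange_number2 U b d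
  = initial_height n lam + \sum_(1 <= a < b) exchange_number2 U a b.
Proof.
move=> bn; rewrite (initial_heightE _ bn) /terminal_height.
under [X in _ + X = _]eq_bigr do rewrite exchange_number2E.
under [X in _ = _ + X]eq_bigr do rewrite exchange_number2E.
rewrite [X in _ + X = _]exchange_big [X in _ = _ + X]exchange_big -!big_split /=.
by apply: eq_bigr => T TT; apply: entry_height_NPS.
Qed.

(** * Interchanging two consecutive entries *)

Section Swap.

Variables i j : 'I_n.+1.
Hypotheses (i_gt0 : 0 < i) (ij : j = i.+1 :> nat).

(** The tableau T with the consecutive entries i and j = i + 1 interchanged. *)
Definition swap T : filling n lam := [ffun x => tperm i j (T x)].

Lemma swapK : involutive swap.
Proof. by move=> T; apply/ffunP => x; rewrite !ffunE tpermK. Qed.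

Lemma swap_tableau T : (swap T \in tableaux n lam) = (T \in tableaux n lam).
Proof.
suff W S : S \in tableaux n lam -> swap S \in tableaux n lam.
  by apply/idP/idP => /W //; rewrite swapK.
have pos (k : 'I_n.+1) : (0 < tperm i j k) = (0 < k).
  by case: tpermP => [->|->|//] /=; rewrite ?ij ?i_gt0.
move=> TS; rewrite inE; apply/andP; split.
  by apply/injectiveP => x y; rewrite !ffunE => /perm_inj/(tableau_inj TS).
apply/eqP/setP => k; rewrite inE; apply/imsetP/idP => [[x _ ->]|k0].
  by rewrite ffunE pos tableau_gt0.
have [|x Sx] := tableau_surj (b := tperm i j k) TS.
  by rewrite pos k0 /= -ltnS ltn_ord.
by exists x; rewrite // ffunE (val_inj Sx) tpermK.
Qed.

(** Only the comparison of i with j is affected by interchanging them. Where j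
    does not occur, the order is thus the same as before. *)
Lemma tperm_lt (u v : 'I_n.+1) : u != j -> v != j ->
  (tperm i j u < tperm i j v) = (u < v).
Proof.
have E (w : 'I_n.+1) : w != j -> (tperm i j w : nat) = if w == i then j else w.
  by case: tpermP => [-> _|-> /eqP//|/eqP/negPf-> _ _]; rewrite ?eqxx.
move=> uj vj; rewrite !E //; move: uj vj; rewrite -!val_eqE /= ij.
case: (eqVneq (val u) i) => [->|]; case: (eqVneq (val v) i) => [->|].
all: by rewrite /=; lia.
Qed.

Lemma tperm_eq_small (u : 'I_n.+1) a : a < i ->
  (tperm i j u == a :> nat) = (u == a :> nat).
Proof. by move=> ai; case: tpermP => [->|->|//]; rewrite ?ij; lia. Qed.

Lemma tperm_eqr (u : 'I_n.+1) : (tperm i j u == j :> nat) = (u == i :> nat).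
Proof.
have E (v w : 'I_n.+1) : (v == w :> nat) = (v == w) by [].
by rewrite !E -{2}(tpermL i j) (inj_eq perm_inj).
Qed.

Lemma tperm_eql (u : 'I_n.+1) : (tperm i j u == i :> nat) = (u == j :> nat).
Proof. by rewrite -tperm_eqr tpermK. Qed.

(** In a run from T that has reached S, the cell r has finished its phase: either
    the phase of an earlier cell c is going on, or the entry of c = r has come to
    rest. *)
Definition dead T r S : Prop := exists c h,
  [/\ phase T S c h, U c <= U r & disordered S h -> U c < U r].

Lemma dead_step T r S : dead T r S -> dead T r (step U S).
Proof.
move=> [c [h [ph le lt]]]; have [dh|nd] := boolP (disordered S h).
  by have := phase_step ph dh; exists c, (min_succ S h); rewrite lt.
case ax: (active_cell U S) => [x|]; last by rewrite /step ax; exists c, h.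
have [ltx px] := phase_next ph nd ax; have [dx _] := active_cell_some ax.
exists x, (min_succ S x); split; [exact: phase_step | lia | lia].
Qed.

(** Entries starting at r or later are not exchanged with smaller ones
    anymore. *)
Lemma dead_exchanges T r S a b q : T \in tableaux n lam -> dead T r S ->
  a < b -> T q = b :> nat -> U r <= U q -> step_exchanges U S a b = false.
Proof.
move=> TT [c [h [ph le lt]]] ab Tq rq.
case ax: (active_cell U S) => [x|]; last exact: step_exchanges_none.
have [dx _] := active_cell_some ax.
have [c' ltc px] : exists2 c', U c' < U r & phase T S c' x.
  have [dh|nd] := boolP (disordered S h).
    by move: ax; rewrite (phase_active ph dh) => -[<-]; exists c => //; apply: lt.
  by have [] := phase_next ph nd ax; exists x => //; lia.
rewrite (step_exchangesE ax) //; apply/andP => -[/eqP Sx _].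
suff e : c' = q by move: ltc; rewrite e; lia.
by apply: (tableau_inj TT); apply: val_inj; rewrite /= -(phase_entry px) Sx Tq.
Qed.

(** The runs from T and from [swap T] are compared when i starts at p, j starts
    at r, and p has its phase before r. *)
Section Simulation.

Variables (T : filling n lam) (p r : cell n lam) (a : nat).
Hypotheses (TT : T \in tableaux n lam) (Tp : T p = i) (Tr : T r = j).
Hypotheses (rp : U r < U p) (ai : a < i).

(** The two runs differ by the interchange of i and j, and they are in the same
    phase, the one of r or one before it, with the same place of the sliding
    entry. *)
Definition parallel S S' : Prop := S' = swap S /\ exists c h,
  [/\ phase T S c h, phase (swap T) S' c h & U r <= U c].

(** The two runs are parallel, or the phase of r is over in both of them. *)
Definition related S S' : Prop :=
  parallel S S' \/ dead T r S /\ dead (swap T) r S'.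

(** For an entry a < i, the next step exchanges a with i in one run if and only
    if it exchanges a with j in the other one. *)
Definition same_exchanges S S' : Prop :=
  step_exchanges U S a i = step_exchanges U S' a j /\
  step_exchanges U S a j = step_exchanges U S' a i.

Let TT' : swap T \in tableaux n lam. Proof. by rewrite swap_tableau. Qed.
Let aj : a < j. Proof. by rewrite ij ltnW. Qed.

Lemma exchange_swap S x y : exchange (swap S) x y = swap (exchange S x y).
Proof. by apply/ffunP => z; rewrite !ffunE. Qed.

Lemma same_exchanges_swap S x : active_cell U S = Some x ->
  active_cell U (swap S) = Some x -> min_succ (swap S) x = min_succ S x ->
  same_exchanges S (swap S).
Proof.
move=> ax ax' em; split.
  rewrite (step_exchangesE ax) // (step_exchangesE ax') // em !ffunE.
  by rewrite (tperm_eq_small _ ai) tperm_eqr.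
rewrite (step_exchangesE ax) // (step_exchangesE ax') // em !ffunE.
by rewrite (tperm_eq_small _ ai) tperm_eql.
Qed.

Lemma dead_related S S' : dead T r S -> dead (swap T) r S' ->
  same_exchanges S S' /\ related (step U S) (step U S').
Proof.
move=> d d'; split; last by right; split; apply: dead_step.
split.
  rewrite (dead_exchanges TT d (q := p)) ?Tp ?(ltnW rp) //.
  by rewrite (dead_exchanges TT' d' (q := p)) ?ffunE ?Tp ?tpermL ?(ltnW rp).
rewrite (dead_exchanges TT d (q := r)) ?Tr //.
by rewrite (dead_exchanges TT' d' (q := r)) ?ffunE ?Tr ?tpermR.
Qed.

Lemma parallel_slide S c h : phase T S c h -> phase (swap T) (swap S) c h ->
  U r <= U c -> disordered S h -> disordered (swap S) h ->
  min_succ (swap S) h = min_succ S h ->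
  same_exchanges S (swap S) /\ related (step U S) (step U (swap S)).
Proof.
move=> ph ph' le d d' em; have ax := phase_active ph d.
have ax' := phase_active ph' d'; split; first exact: same_exchanges_swap em.
left; split; first by rewrite (step_active ax) (step_active ax') em exchange_swap.
exists c, (min_succ S h); split=> //; first exact: phase_step.
by have := phase_step ph' d'; rewrite em.
Qed.

(** Before the phase of r, the entry j is still at r in the first run, so that
    all comparisons in the ordered region have the same result in both runs. *)
Lemma above_disordered S z : S \in tableaux n lam -> S r = j -> U r < U z ->
  disordered (swap S) z = disordered S z /\
  (disordered S z -> min_succ (swap S) z = min_succ S z).
Proof.
move=> TS Sr rz.
have TS' : swap S \in tableaux n lam by rewrite swap_tableau.
have nj w : U r < U w -> S w != j.
  by apply: contraTneq; rewrite -Sr => /(tableau_inj TS)->; rewrite ltnn.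
have lts w : w \in succs z -> U r < U w.
  by move=> /(SYT_succ hU); apply: ltn_trans.
have em : succs z != set0 -> min_succ (swap S) z = min_succ S z.
  case/set0Pn => w zw; have [zy _] := min_succP S zw.
  apply: min_succ_unique => // w' zw'; have [_ le] := min_succP S zw'.
  by rewrite leqNgt !ffunE tperm_lt ?nj ?lts // -leqNgt.
split; last by case/andP => /em.
rewrite /disordered; case: (boolP (succs z == set0)) => //= ne.
rewrite em // !ffunE tperm_lt ?nj //; apply: lts.
by case/set0Pn: ne => w zw; have [] := min_succP S zw.
Qed.

(** In the phase of r, the sliding entry is j in the first run and i in the
    second one. Both pass the same entries smaller than i. If j then meets i in
    the first run, these two are exchanged and j comes to rest, as its new
    successors exceed i; in the second run, i already is at rest. *)
Lemma parallel_last S h : phase T S r h -> phase (swap T) (swap S) r h ->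
  same_exchanges S (swap S) /\ related (step U S) (step U (swap S)).
Proof.
move=> ph ph'; have TS := phase_tableau ph.
have Sh : S h = j by rewrite (phase_entry ph).
have Sh' : swap S h = i by rewrite ffunE Sh tpermR.
have [d'|nd'] := boolP (disordered (swap S) h).
  (* The entry i still moves in the second run, so it meets an entry below i. *)
  have [hy lt] := disordered_min d'.
  have small w : swap S w < i -> swap S w = S w.
    rewrite ffunE; case: (tpermP i j (S w)) => [->|->|//]; last by rewrite ltnn.
    by rewrite ij ltnNge leqnSn.
  have Sy := lt; rewrite Sh' in Sy.
  have em : min_succ S h = min_succ (swap S) h.
    apply: min_succ_unique => // w hw; rewrite -small //.
    have [_ le] := min_succP (swap S) hw.
    have [/small<-//|ge] := ltnP (swap S w) i.
    apply: (leq_trans (ltnW Sy)); move: ge; rewrite ffunE.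
    by case: (tpermP i j (S w)) => [->|->|//]; rewrite ?ij // leqnSn.
  have d : disordered S h.
    rewrite /disordered em Sh -small // ij (ltnW _) ?ltnS ?(ltnW Sy) // andbT.
    by apply/set0Pn; exists (min_succ (swap S) h).
  exact: (parallel_slide ph ph').
have dd' : dead (swap T) r (swap S) by exists r, h; rewrite (negPf nd').
have [d|nd] := boolP (disordered S h); last first.
  by apply: dead_related => //; exists r, h; rewrite (negPf nd).
(* Only j moves: it can do so only by an exchange with i. *)
have [hy lt] := disordered_min d; have ax := phase_active ph d.
have Sy : S (min_succ S h) = i :> nat.
  apply/eqP; rewrite eqn_leq -ltnS -ij -Sh lt /= leqNgt; apply/negP => lt'.
  have := ordered_succ (phase_tableau ph') nd' hy; rewrite Sh' ffunE tpermD.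
  - by rewrite ltnNge ltnW.
  - by apply: contraTneq lt' => <-; rewrite ltnn.
  - by apply: contraTneq lt' => <-; rewrite ij ltnNge leqnSn.
split.
  have rpl := ltnW rp; split; rewrite (step_exchangesE ax) // Sy Sh.
    rewrite (dead_exchanges TT' dd' (q := p)) ?ffunE ?Tp ?tpermL //.
    by rewrite ij (gtn_eqF (ltnSn _)).
  rewrite (dead_exchanges TT' dd' (q := r)) ?ffunE ?Tr ?tpermR //.
  by rewrite (gtn_eqF ai) andbF.
right; split; last exact: dead_step.
exists r, (min_succ S h); split=> //; first exact: phase_step.
suff /negPf-> : ~~ disordered (step U S) (min_succ S h) by [].
apply: disorderedN => w yw; rewrite (step_active ax) !ffunE tpermR.
have wy := succ_neq yw; have wh : w != h.
  exact: succ_succ_neq hy yw.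
rewrite tpermD 1?eq_sym // Sh ij ltn_neqAle.
have Syw : S (min_succ S h) < S w.
  apply: (phase_ordered ph) => //; last exact: succ_neq.
  by apply: leq_trans (phase_le ph) (ltnW (SYT_succ hU hy)).
rewrite -Sy Syw andbT Sy -ij; apply: contra wh => /eqP e.
by apply/eqP/(tableau_inj TS)/val_inj; rewrite /= -e Sh.
Qed.

Lemma parallel_related S S' : parallel S S' ->
  same_exchanges S S' /\ related (step U S) (step U S').
Proof.
case=> -> [c [h [ph ph' le]]].
have [m] := ubnP (U c); elim: m c h ph ph' le => // m IH c h ph ph' le lem.
have [ec|ne] := eqVneq c r; first by subst c; apply: parallel_last ph ph'.
have rc : U r < U c.
  rewrite ltn_neqAle le andbT eq_sym; apply: contra ne => /eqP e.
  by apply/eqP/(tableau_inj (SYT_tableau hU))/val_inj.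
have TS := phase_tableau ph.
have Sr : S r = j by rewrite (phase_initial ph rc).
have [ed em] := above_disordered TS Sr (leq_trans rc (phase_le ph)).
have [d|nd] := boolP (disordered S h).
  by apply: (parallel_slide ph ph') => //; rewrite ?ed // em.
(* Nothing moves in this phase anymore: pass to the preceding cell c'. *)
case: (arg_maxnP (P := fun z => U z < U c) (fun z => U z : nat) rc) => c' lt mx.
have btw z : U c' < U z < U c -> False.
  by case/andP => lz /mx /=; rewrite leqNgt lz.
apply: (IH c' c').
- by apply: (phase_restart ph) => // z /btw.
- by apply: (phase_restart ph') => //; [rewrite ed | move=> z /btw].
- exact: mx.
- by apply: leq_trans lt _.
Qed.

Lemma related_iter s :
  related (iter s (step U) T) (iter s (step U) (swap T)).
Proof.
elim: s => [|s [/parallel_related[]|[d d']]] //=; last by case: (dead_related d d').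
have [c ph mx] := phase0 r TT; left; split=> //; exists c, c; split=> //.
by apply: phase_start => // z; rewrite ltnNge mx.
Qed.

Lemma same_exchanges_iter s :
  same_exchanges (iter s (step U) T) (iter s (step U) (swap T)).
Proof.
by case: (related_iter s) => [/parallel_related[]|[d d']] //; case: (dead_related d d').
Qed.

End Simulation.

Lemma exchanged_swap T a : T \in tableaux n lam -> a < i ->
  exchanged (swap T) a j = exchanged T a i.
Proof.
move=> TT ai; have TT' : swap T \in tableaux n lam by rewrite swap_tableau.
have [|p /val_inj Tp] := tableau_surj (b := i) TT.
  by rewrite i_gt0 /= -ltnS ltn_ord.
have [|r /val_inj Tr] := tableau_surj (b := j) TT.
  by rewrite {1}ij /= -ltnS ltn_ord.
suff E s : step_exchanges U (iter s (step U) (swap T)) a j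
         = step_exchanges U (iter s (step U) T) a i.
  by apply/exchangedP/exchangedP => // -[s]; rewrite ?E => Es; exists s; rewrite ?E.
(* If r has its phase first, the roles of T and of swap T are interchanged. *)
have [lt|lt|/val_inj e] := ltngtP (U r) (U p).
- by have [-> _] := same_exchanges_iter TT Tp Tr lt ai s.
- have [||_] := same_exchanges_iter TT' (p := r) (r := p) _ _ lt ai s.
  + by rewrite ffunE Tr tpermR.
  + by rewrite ffunE Tp tpermL.
  + by rewrite swapK.
- have := Tr; rewrite (tableau_inj (SYT_tableau hU) e) Tp => /(congr1 val) /=.
  by rewrite ij => /n_Sn.
Qed.

Lemma exchange_number2_succ a : a < i ->
  exchange_number2 U a j = exchange_number2 U a i.
Proof.
move=> ai; rewrite !exchange_number2E (reindex_inj (inv_inj swapK)) /=.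
apply: eq_big => T; first exact: swap_tableau.
by rewrite swap_tableau => TT; rewrite exchanged_swap.
Qed.

End Swap.

Lemma exchange_number2_indep a b : a < b <= n ->
  exchange_number2 U a b = exchange_number U a.
Proof.
case/andP => ab bn; suff E d : b + d <= n ->
    exchange_number2 U a (b + d) = exchange_number2 U a b.
  by rewrite /exchange_number -(E (n - b)) subnKC.
elim: d => [|d IH]; first by rewrite addn0.
rewrite addnS => le; rewrite -IH; last exact: ltnW.
have lt : b + d < n.+1 by apply: ltnW.
apply: (exchange_number2_succ (i := Ordinal lt) (j := Ordinal (le : (b + d).+1 < n.+1))) => //=.
- by lia.
- by lia.
Qed.

(** * The recursion *)

Lemma exchange_number_recursion b : 0 < b <= n ->
  terminal_height U b + (n - b) * exchange_number U b
  = initial_height n lam + \sum_(1 <= a < b) exchange_number U a.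
Proof.
move=> bn; have := terminal_height_balance bn.
rewrite (eq_big_nat _ _ (F2 := fun=> exchange_number U b)); last first.
  by move=> d /andP[bd dn]; apply: exchange_number2_indep; lia.
rewrite sum_nat_const_nat subSS => ->; congr (_ + _).
by apply: eq_big_nat => a ab; apply: exchange_number2_indep; lia.
Qed.

End NPS.

Import GRing.Theory Num.Theory.
Local Open Scope ring_scope.

Theorem theorem4p4 (n : nat) (lam : seq nat) (hlam : is_partition n lam)
    (U : filling n lam) (hU : U \in SYT n lam)
    (b : nat) (hb : (1 <= b <= n)%N) :
  (n%:Z - b%:Z) * (exchange_number U b)%:Z =
    (initial_height n lam)%:Z - (terminal_height U b)%:Z
    + \sum_(1 <= a < b) (exchange_number U a)%:Z.
Proof.
have /(congr1 Posz) := exchange_number_recursion hlam hU hb.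
case/andP: hb => _ bn.
rewrite !PoszD PoszM -subzn // (big_morph Posz PoszD (erefl _)).
by move=> e; rewrite addrAC -e addrAC subrr add0r.
Qed.
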